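(* Let $n\ge 2$ and let $G_n$ be the $n\times n$ matrix whose $(p,q)$ entry is $2^{q-p+1}$ if $q\ge p$, $2$ if $q=p-1$, and $0$ if $q<p-1$. Let $x=(x_{n-1},x_{n-2},\ldots,x_{0})^{\top}$ be an eigenvector of $G_n$ associated to an eigenvalue $\lambda$. Then for all $i=1,\dots,n-1$, $$x_{i} = \left(-\frac{1}{2}\right)^{i}g_{i}(\lambda)x_{0},$$ where $g_{i}(\lambda)$ is the characteristic polynomial of the $i\times i$ matrix $G_{i}$.
   Context: The characteristic polynomial of an $i\times i$ matrix $G_i$ is $\det(G_i-\lambda I)$. The matrix $G_i$ is defined by the same entry formula with size $i$. The entries of $x$ are indexed in decreasing order, so $x_0$ is the last entry. *)

(* Defs.v *)
From HB Require Import structures.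
From mathcomp Require Import all_boot all_order all_algebra.

Set Implicit Arguments.
Unset Strict Implicit.
Unset Printing Implicit Defensive.

Import Order.TTheory GRing.Theory Num.Theory.

Local Open Scope ring_scope.

(* Rows and columns are numbered from 0; the entries depend only on [q - p], so
   the formula is the same as with numbering from 1. *)
Definition G (F : numFieldType) (n : nat) : 'M[F]_n :=
  \matrix_(p < n, q < n)
    if (p <= q)%N then 2 ^+ (q - p + 1)
    else if (q + 1 == p)%N then 2
    else 0.

(* [det (A - X I)]; the library's [char_poly A] is [det (X I - A)], which
   differs from it by the sign [(-1) ^+ n]. *)
Definition charpoly (F : fieldType) (n : nat) (A : 'M[F]_n) : {poly F} :=
  \det (map_mx polyC A - 'X%:M).

(* Column eigenvectors; the library's [eigenspace] consists of row vectors. *)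
Definition eigenvector (F : fieldType) (n : nat) (A : 'M[F]_n) (lambda : F)
    (x : 'cV[F]_n) : Prop :=
  x != 0 /\ A *m x = lambda *: x.

(* Entries numbered in decreasing order, [x = (x_{n-1}, ..., x_0)^T]. *)
Definition entry (F : fieldType) (n : nat) (x : 'cV[F]_n) (i : 'I_n) : F :=
  x (rev_ord i) 0.

(* Main.v *)
(** Cramer's rule. Let [v] be the vector of the last [i] entries of [x]. The last
    [i] rows of [G_n x = lambda x] say that [(G_i - lambda) v] is
    [(- 2 x_i, 0, ..., 0)^T]. Applying the adjugate of [G_i - lambda] and reading
    the last entry gives [g_i(lambda) x_0 = C * (- 2 x_i)], where the cofactor [C]
    of the top right corner is [(- 2) ^ (i - 1)], because deleting the first row
    and the last column of [G_i - lambda] leaves a triangular matrix with [2] on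
    its diagonal. *)
Require Import Defs.
From HB Require Import structures.
From mathcomp Require Import all_boot all_order all_algebra.

Set Implicit Arguments.
Unset Strict Implicit.
Unset Printing Implicit Defensive.

Import Order.TTheory GRing.Theory Num.Theory.

Local Open Scope ring_scope.

Lemma horner_charpoly (F : fieldType) n (A : 'M[F]_n) a :
  (charpoly A).[a] = \det (A - a%:M).
Proof.
rewrite /charpoly -[LHS]/(horner_eval a _) -det_map_mx; congr (\det _).
apply/matrixP=> p q.
by rewrite !mxE rmorphB rmorphMn /= /horner_eval hornerC hornerX.
Qed.

Lemma cofactor_corner_G (F : numFieldType) m (a : F) :
  cofactor (G F m.+1 - a%:M) 0 ord_max = (- 2) ^+ m.
Proof.
have bump_max (p : 'I_m) : bump m p = p by exact: lift_max p.
(* [det_trig] wants zeros above the diagonal, hence the transpose. In the minor itself, [a] sits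
   only just above the diagonal. *)
rewrite /cofactor add0n /= -det_tr det_trig.
  rewrite (eq_bigr (fun=> 2)) ?prodr_const ?card_ord -?exprMn ?mulN1r // => p _.
  rewrite !mxE -val_eqE /= bump_max /bump leq0n add1n.
  by rewrite ltnn addn1 eqxx gtn_eqF // subr0.
apply/is_trig_mxP => p q lt_pq; have lt_pSq : (p < q.+1)%N := ltnW lt_pq.
rewrite !mxE -val_eqE /= bump_max /bump leq0n add1n.
by rewrite leqNgt lt_pSq /= addn1 eqSS (ltn_eqF lt_pq) gtn_eqF // subr0.
Qed.

(** In the last [m.+1] rows, the first [d.+1] columns hold a single nonzero entry, the subdiagonal
    [2] in column [d]. The other columns form [G F m.+1], as entries depend only on [q - p]. *)
Lemma G_sub_mulmx_dsubmx (F : numFieldType) d m (a : F)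
    (x : 'cV[F]_(d.+1 + m.+1)) :
  G F (d.+1 + m.+1) *m x = a *: x ->
  (G F m.+1 - a%:M) *m dsubmx x
    = (- 2 * x (lshift m.+1 ord_max) 0) *: delta_mx 0 0.
Proof.
move=> Gx; apply/colP=> p; have /colP/(_ (rshift d.+1 p)) := Gx.
rewrite mulmxBl mul_scalar_mx !mxE big_split_ord /= => Gxp.
apply/eqP; rewrite subr_eq -{}Gxp; apply/eqP.
rewrite [X in _ = _ + (X + _)](bigD1 ord_max) //= [X in _ + X + _]big1; last first.
  move=> q neq_q_d; rewrite !mxE /= leqNgt ltn_addr ?ltn_ord //=.
  have /ltn_eqF-> : (q + 1 < d.+1 + p)%N; last by rewrite mul0r.
  rewrite addn1 addSn ltnS ltn_addr // ltn_neqAle -ltnS ltn_ord andbT.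
  by rewrite -val_eqE in neq_q_d.
rewrite !mxE /= addr0 [X in _ = _ + (_ + X)](eq_bigr
  (fun q => G F m.+1 p q * dsubmx x q 0)); last first.
  by move=> q _; rewrite !mxE /= leq_add2l subnDl -addnA eqn_add2l.
rewrite addrA -[LHS]add0r; congr (_ + _).
rewrite andbT leqNgt ltn_addr ?ltnSn //= [(d.+1 + p)%N]addSnnS eqn_add2l.
rewrite eqSS (eq_sym 0%N) -val_eqE /=.
by case: eqP => _; rewrite ?mulr1 ?mulr0 ?mul0r ?addr0 // mulNr addNr.
Qed.

Lemma det_G_sub (F : numFieldType) d m (a : F) (x : 'cV[F]_(d.+1 + m.+1)) :
  G F (d.+1 + m.+1) *m x = a *: x ->
  \det (G F m.+1 - a%:M) * x (rshift d.+1 ord_max) 0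
    = (- 2) ^+ m.+1 * x (lshift m.+1 ord_max) 0.
Proof.
move=> /G_sub_mulmx_dsubmx /(congr1 (mulmx (\adj (G F m.+1 - a%:M)))).
rewrite mulmxA mul_adj_mx mul_scalar_mx -scalemxAr -colE.
(* The adjugate transposes, so the last entry of its column [0] is the cofactor at
   [(0, ord_max)]. *)
move=> /colP/(_ ord_max); rewrite !mxE cofactor_corner_G => ->.
by rewrite mulrAC -exprS.
Qed.

Theorem corollary4 (F : numFieldType) (n : nat) (hn : (2 <= n)%N)
    (lambda : F) (x : 'cV[F]_n) (hx : eigenvector (G F n) lambda x) :
  forall i : 'I_n, (1 <= i)%N ->
    entry x i =
      (- (1 / 2)) ^+ i * (charpoly (G F i)).[lambda]
        * entry x (Ordinal (ltnW hn)).
Proof.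
case=> [[|m] //= lt_m_n _].
have [d def_n] : exists d, n = (d.+1 + m.+1)%N.
  (* With [i = m.+1], the entry [x_i] has [d = n - i - 1] entries above it. *)
  by exists (n - m.+2)%N; rewrite addSnnS subnK.
subst n; case: hx => _ /det_G_sub; rewrite -horner_charpoly /entry => det_x.
have -> : rev_ord (Ordinal lt_m_n) = lshift m.+1 ord_max.
  by apply: val_inj; rewrite /= addSnnS addnK.
have -> : rev_ord (Ordinal (ltnW hn)) = rshift d.+1 ord_max.
  by apply: val_inj; rewrite /= subn1 addnS.
rewrite -mulrA det_x mulrA -exprMn mulrNN mul1r mulVf ?pnatr_eq0 //.
by rewrite expr1n mul1r.
Qed.
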